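(* Let $T$ and $S$ be bounded, linear, positive operators on $L^2(G,\mathbb{C}^{s\times r})$ that are adjointable with respect to the matrix-valued inner product, and let $\{E_k\}_{k\in\mathbb{N}}$ be a matrix-valued orthonormal basis for $L^2(G,\mathbb{C}^{s\times r})$. Let $I$ be the identity operator. Then: (1) $\{(I+T)E_k\}_{k\in\mathbb{N}}$ and $\{(I+S)E_k\}_{k\in\mathbb{N}}$ are matrix-valued Riesz bases for $L^2(G,\mathbb{C}^{s\times r})$; (2) $\{(I+T+S)E_k\}_{k\in\mathbb{N}}$ is a matrix-valued Riesz basis for $L^2(G,\mathbb{C}^{s\times r})$; (3) if $TS=ST$, then $\{(I+TS)E_k\}_{k\in\mathbb{N}}$ is a matrix-valued Riesz basis for $L^2(G,\mathbb{C}^{s\times r})$.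
   Context: $G$ is a locally compact abelian group that is metrizable and $\sigma$-compact, with Haar measure $\mu_G$; $s,r\in\mathbb{N}$. $L^2(G,\mathbb{C}^{s\times r})$ is the space of $s\times r$ matrices $\mathbf{f}=[f_{ij}]$ with all entries in $L^2(G)$. The matrix-valued inner product is $\langle \mathbf{f},\mathbf{g}\rangle=\int_G \mathbf{f}(x)\mathbf{g}^*(x)\,d\mu_G\in M_s(\mathbb{C})$ (entrywise integral). $L^2(G,\mathbb{C}^{s\times r})$ is a Hilbert space with inner product $\langle \mathbf{f},\mathbf{g}\rangle_{L^2}=\mathrm{tr}\langle \mathbf{f},\mathbf{g}\rangle$ and Frobenius norm $\|\mathbf{f}\|=(\sum_{i,j}\int_G|f_{ij}|^2d\mu_G)^{1/2}$; $U^*$ denotes the Hilbert-adjoint of a bounded operator $U$ with respect to this inner product. $U$ is adjointable with respect to the matrix-valued inner product if $\langle U\mathbf{f},\mathbf{g}\rangle=\langle\mathbf{f},U^*\mathbf{g}\rangle$ for all $\mathbf{f},\mathbf{g}$. A bounded operator $T$ is positive if it is self-adjoint ($T^*=T$) and $\mathrm{tr}\langle T\mathbf{f},\mathbf{f}\rangle\ge0$ for all $\mathbf{f}$. A matrix-valued orthonormal basis is a sequence $\{E_k\}_{k\in\mathbb{N}}\subset L^2(G,\mathbb{C}^{s\times r})$ with $\langle E_k,E_j\rangle=\mathbf{I}_{s\times s}$ if $k=j$ and $\mathbf{O}_{s\times s}$ if $k\neq j$, such that every $\mathbf{f}$ satisfies $\mathbf{f}=\sum_k\langle\mathbf{f},E_k\rangle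 E_k$ with convergence in the Frobenius norm. A matrix-valued Riesz basis is a family of the form $\{UE_k\}_{k\in\mathbb{N}}$ where $\{E_k\}$ is a matrix-valued orthonormal basis and $U$ is a bounded, linear, bijective operator on $L^2(G,\mathbb{C}^{s\times r})$ that is adjointable with respect to the matrix-valued inner product. *)

(* Defs.v *)
(* mathcomp-analysis (measure theory, Lebesgue integral)
   + mathcomp-real-closed (complex numbers R[i]). *)
From HB Require Import structures.
From mathcomp Require Import all_boot all_order all_algebra.
From mathcomp Require Import all_classical all_reals all_analysis.
From mathcomp Require Import complex.
Set Implicit Arguments.
Unset Strict Implicit.
Unset Printing Implicit Defensive.
Import Order.TTheory GRing.Theory Num.Theory numFieldNormedType.Exports.
Local Open Scope classical_set_scope.
Local Open Scope ring_scope.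

(* G equipped with its Borel sigma-algebra (generated by the open sets). *)
Definition borel (G : topologicalZmodType) : Type := G.
Section BorelInstance.
Variable G : topologicalZmodType.
HB.instance Definition _ := Choice.on (borel G).
HB.instance Definition _ := isPointed.Build (borel G) 0.
Lemma borel_sigmaC (A : set G) : <<s open >> A -> <<s (@open G) >> (~` A).
Proof. by move=> sGA; rewrite -setTD; exact: sigma_algebraCD. Qed.
HB.instance Definition _ := @isMeasurable.Build (sigma_display (@open G))
  (borel G) <<s (@open G) >> (@sigma_algebra0 _ setT (@open G)) (@borel_sigmaC)
  (@sigma_algebra_bigcup _ setT (@open G)).
End BorelInstance.

(** ** Standing assumptions on the group G *)
Section GroupAssumptions.
Variables (R : realType) (G : topologicalZmodType).

(* G is metrizable: some metric on G induces its topology. *)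
Definition metrizable_space : Prop :=
  exists dist : G -> G -> R,
    [/\ (forall x y, 0 <= dist x y),
        (forall x y, dist x y = 0 <-> x = y),
        (forall x y, dist x y = dist y x),
        (forall x y z, dist x z <= dist x y + dist y z) &
        (forall A : set G, open A <->
           (forall x, A x -> exists2 e : R, 0 < e & [set y | dist x y < e] `<=` A))].

(* G is sigma-compact: a countable union of compact sets. *)
Definition sigma_compact_space : Prop :=
  exists K : nat -> set G, (forall n, compact (K n)) /\ \bigcup_n K n = setT.

(* G is locally compact. *)
Definition locally_compact_space : Prop := locally_compact [set: G].

(* mu is a (left) Haar measure on the Borel sets of G: a nonzero,
   translation-invariant Radon measure (finite on compact sets, outer
   regular on Borel sets, inner regular on open sets). *)
Definition haar_measure (mu : {measure set (borel G) -> \bar R}) : Prop :=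
  [/\ mu setT <> 0%E,
      (forall (x : G) (A : set (borel G)), measurable A ->
          mu [set x + a | a in A] = mu A),
      (forall K : set G, compact K -> (mu K < +oo)%E),
      (forall A : set (borel G), measurable A ->
          mu A = ereal_inf [set mu U | U in [set U : set G | open U /\ A `<=` U]]) &
      (forall U : set G, open U ->
          mu U = ereal_sup [set mu K | K in [set K : set G | compact K /\ K `<=` U]])].

End GroupAssumptions.

(** ** The space L^2(G, C^{s x r}) *)
Section L2Matrix.
Variables (R : realType) (G : topologicalZmodType)
  (mu : {measure set (borel G) -> \bar R}) (s r : nat).

Local Notation C := R[i].
Local Notation M := 'M[C]_(s, r).
(* Elements are represented by functions G -> C^{s x r}; elements of
   the Hilbert space are their classes modulo [l2eq] below. *)
Local Notation Fn := (G -> M).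

(* |z|^2 for a complex number z *)
Definition csq (z : C) : R := complex.Re z ^+ 2 + complex.Im z ^+ 2.

(* integral over G of a complex-valued function *)
Definition cint (h : G -> C) : C :=
  Complex (Rintegral mu setT (fun x => complex.Re (h x)))
          (Rintegral mu setT (fun x => complex.Im (h x))).

(* all entries are (measurable and) square integrable *)
Definition is_L2 (f : Fn) : Prop :=
  forall i j,
    [/\ measurable_fun (setT : set (borel G)) (fun x => complex.Re (f x i j)),
        measurable_fun (setT : set (borel G)) (fun x => complex.Im (f x i j)) &
        (\int[mu]_x (csq (f x i j))%:E < +oo)%E].

(* matrix-valued inner product <f, g> = \int_G f(x) g(x)^* dmu *)
Definition mxip (f g : Fn) : 'M[C]_s :=
  \matrix_(i < s, k < s) \sum_(j < r) cint (fun x => f x i j * (g x k j)^*).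

(* scalar inner product tr <f, g> *)
Definition hip (f g : Fn) : C := \tr (mxip f g).

(* Frobenius norm *)
Definition fnorm (f : Fn) : R :=
  Num.sqrt (\sum_(i < s) \sum_(j < r) Rintegral mu setT (fun x => csq (f x i j))).

(* equality in L^2 (i.e. almost everywhere) *)
Definition l2eq (f g : Fn) : Prop := fnorm (fun x => f x - g x) = 0.

(* Operators are represented by maps on representatives. *)
Definition bounded_linear_op (U : Fn -> Fn) : Prop :=
  [/\ (forall f, is_L2 f -> is_L2 (U f)),
      (forall f g, is_L2 f -> is_L2 g -> l2eq f g -> l2eq (U f) (U g)),
      (forall (a : C) f g, is_L2 f -> is_L2 g ->
          l2eq (U (fun x => a *: f x + g x)) (fun x => a *: U f x + U g x)) &
      (exists K : R, forall f, is_L2 f -> fnorm (U f) <= K * fnorm f)].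

Definition op_bijective (U : Fn -> Fn) : Prop :=
  (forall f g, is_L2 f -> is_L2 g -> l2eq (U f) (U g) -> l2eq f g) /\
  (forall g, is_L2 g -> exists2 f, is_L2 f & l2eq (U f) g).

(* V is the Hilbert adjoint U^* of U w.r.t. the scalar inner product *)
Definition is_hadjoint (U V : Fn -> Fn) : Prop :=
  bounded_linear_op V /\
  forall f g, is_L2 f -> is_L2 g -> hip (U f) g = hip f (V g).

(* U is adjointable w.r.t. the matrix-valued inner product *)
Definition mx_adjointable (U : Fn -> Fn) : Prop :=
  exists V, is_hadjoint U V /\
    forall f g, is_L2 f -> is_L2 g -> mxip (U f) g = mxip f (V g).

(* positive operator: self-adjoint and tr <Tf, f> >= 0 *)
Definition positive_op (T : Fn -> Fn) : Prop :=
  is_hadjoint T T /\ forall f, is_L2 f -> 0 <= hip (T f) f.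

(* matrix-valued orthonormal basis *)
Definition mx_onb (E : nat -> Fn) : Prop :=
  [/\ (forall k, is_L2 (E k)),
      (forall k j, mxip (E k) (E j) = if k == j then 1%:M else 0) &
      (forall f, is_L2 f ->
         (fun n => fnorm (fun x => f x - \sum_(k < n) mxip f (E k) *m E k x))
           @ \oo --> (0 : R))].

(* matrix-valued Riesz basis *)
Definition mx_riesz_basis (F : nat -> Fn) : Prop :=
  exists (E : nat -> Fn) (U : Fn -> Fn),
    [/\ mx_onb E, bounded_linear_op U, op_bijective U, mx_adjointable U &
        forall k, l2eq (F k) (U (E k))].

End L2Matrix.

(* Main.v *)
(* If A is bounded, self-adjoint and positive, then P = I + A satisfies
   |f|^2 <= <P f, f>, so f |-> f - c P f contracts the norm for small c > 0 and
   Richardson iteration inverts P. The iteration converges because a series in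
   L^2 with geometrically decaying norms can be summed pointwise: with weights
   w^k, Cauchy-Schwarz bounds the squared tail by w^n / (1 - w) times
   sum_k u_k^2 / w^k, which has finite integral.
   This applies to A = T, S and T + S. For commuting T and S it applies to
   A = T S, which is positive by a device of F. Riesz: scale S to S <= I, let
   S_0 = S and S_(n+1) = S_n - S_n^2, so that 0 <= S_n <= I and
   S = sum_(k < n) S_k^2 + S_n. Then sum_k |S_k f|^2 <= <S f, f> forces
   S_n f to be small for some n, while
   <T S f, f> = sum_(k < n) <T S_k f, S_k f> + <S_n f, T f>. *)
Require Import Defs.
From mathcomp Require Import all_boot all_order all_algebra.
From mathcomp Require Import all_classical all_reals all_analysis.
From mathcomp Require Import measurable_realfun.
From mathcomp Require Import complex.
From mathcomp Require Import ring lra.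
Set Implicit Arguments.
Unset Strict Implicit.
Unset Printing Implicit Defensive.
Import Order.TTheory GRing.Theory Num.Theory numFieldNormedType.Exports.
Local Open Scope classical_set_scope.
Local Open Scope ring_scope.

(** * Bijectivity and positivity for a positive semidefinite form *)

(** Turns a geometrically small error bound, valid at every stage of an iteration, into an exact
    conclusion. *)
Lemma le0_of_le_geometric (R : realType) (x K w : R) :
  0 < w < 1 -> (forall n, x <= K * w ^+ n) -> x <= 0.
Proof.
move=> /andP[w0 w1] h.
have cv : (fun n => K * w ^+ n) @ \oo --> (0 : R).
  have := @cvg_geometric _ K w; rewrite ger0_norm ?ltW//; exact.
rewrite -(cvg_lim _ cv)//; apply: limr_ge; first by apply/cvg_ex; exists 0.
by apply: nearW.
Qed.

Section HilbertForm.
Variables (R : realType) (V : lmodType R[i]).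
Implicit Types (D : V -> Prop) (B : V -> V -> R).

(* A Hilbert space presented by representatives: the real part [B] of the inner
   product is only semidefinite, and completeness is required only for
   series with geometrically decaying terms. *)
Record hilbert_form D B : Prop := HilbertForm {
  hilbert_form0 : D 0;
  hilbert_formP : forall (a : R[i]) f g, D f -> D g -> D (a *: f + g);
  hilbert_formC : forall f g, B f g = B g f;
  hilbert_form_linear : forall (a : R) f g h, D f -> D g -> D h ->
    B (a%:C%C *: f + g) h = a * B f h + B g h;
  hilbert_form_ge0 : forall f, D f -> 0 <= B f f;
  hilbert_form_complete : forall (u : nat -> V) (K w : R),
    (forall n, D (u n)) -> 0 < w < 1 ->
    (forall n, B (u n) (u n) <= K * (w ^+ n) ^+ 2) ->
    exists2 f, D f & exists L, forall n,
      B (f - \sum_(k < n) u k) (f - \sum_(k < n) u k) <= L * w ^+ n }.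

(** This also stands in for linearity: on representatives an operator is linear only up to null
    vectors of [B], but moved to the other argument of [B] it acts linearly. *)
Definition form_selfadjoint D B (T : V -> V) : Prop :=
  (forall f, D f -> D (T f)) /\
  (forall f g, D f -> D g -> B (T f) g = B f (T g)).

Definition form_ge0 D B (T : V -> V) : Prop := forall f, D f -> 0 <= B (T f) f.

Variables (D : V -> Prop) (B : V -> V -> R).
Hypothesis H : hilbert_form D B.

Let D0 : D 0 := hilbert_form0 H.
Let BC f g : B f g = B g f := hilbert_formC H f g.

Let DD f g : D f -> D g -> D (f + g).
Proof. by move=> ? ?; rewrite -(scale1r f); apply: (hilbert_formP H). Qed.

Let DZ (a : R[i]) f : D f -> D (a *: f).
Proof. by move=> ?; rewrite -[_ *: _]addr0; apply: (hilbert_formP H). Qed.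

Let DB f g : D f -> D g -> D (f - g).
Proof. by move=> ? ?; rewrite -scaleN1r; apply: DD => //; apply: DZ. Qed.

Let Dsum n (u : nat -> V) : (forall k, D (u k)) -> D (\sum_(k < n) u k).
Proof.
by move=> Du; elim: n => [|n IH]; rewrite ?big_ord0// big_ord_recr; apply: DD.
Qed.

Lemma formDl f g h : D f -> D g -> D h -> B (f + g) h = B f h + B g h.
Proof.
move=> Df Dg Dh; have := hilbert_form_linear H 1 Df Dg Dh.
by rewrite scale1r mul1r.
Qed.

Lemma form0l h : D h -> B 0 h = 0.
Proof.
by move=> Dh; have := formDl D0 D0 Dh; rewrite addr0 => e; lra.
Qed.

Lemma formZl (a : R) f h : D f -> D h -> B (a%:C%C *: f) h = a * B f h.
Proof.
move=> Df Dh; have := hilbert_form_linear H a Df D0 Dh.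
by rewrite addr0 form0l// addr0.
Qed.

Lemma formBl f g h : D f -> D g -> D h -> B (f - g) h = B f h - B g h.
Proof.
move=> Df Dg Dh.
have := hilbert_form_linear H (-1) Dg Df Dh.
have -> : ((-1 : R)%:C)%C = -1 by rewrite rmorphN rmorph1.
by rewrite scaleN1r addrC => ->; ring.
Qed.

Lemma formDr f g h : D f -> D g -> D h -> B h (f + g) = B h f + B h g.
Proof. by move=> *; rewrite BC formDl// !(BC h). Qed.

Lemma formBr f g h : D f -> D g -> D h -> B h (f - g) = B h f - B h g.
Proof. by move=> *; rewrite BC formBl// !(BC h). Qed.

Lemma formZr (a : R) f h : D f -> D h -> B h (a%:C%C *: f) = a * B h f.
Proof. by move=> *; rewrite BC formZl// BC. Qed.

Lemma form_cauchy_schwarz f g : D f -> D g -> B f g ^+ 2 <= B f f * B g g.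
Proof.
move=> Df Dg.
have key t : 0 <= B f f - 2 * t * B f g + t ^+ 2 * B g g.
  have Dt : D (t%:C%C *: g) by apply: DZ.
  have := hilbert_form_ge0 H (DB Df Dt).
  rewrite formBl ?formBr ?formZl ?formZr//; last exact: DB.
  by rewrite (BC g f); lra.
have [g0|g0] := eqVneq (B g g) 0.
  have -> : B f g = 0; last by rewrite g0 expr0n mulr0.
  apply/eqP; apply: contraT => fg0.
  (* With [B g g = 0] the polynomial is affine in [t]; this [t] gives it the value -1. *)
  have := key ((B f f + 1) / (2 * B f g)); rewrite g0.
  have -> : 2 * ((B f f + 1) / (2 * B f g)) * B f g = B f f + 1 by field.
  lra.
have gp : 0 < B g g by rewrite lt_neqAle eq_sym g0 (hilbert_form_ge0 H).
(* The minimiser of the quadratic polynomial. *)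
have := key (B f g / B g g).
have -> : B f f - 2 * (B f g / B g g) * B f g + (B f g / B g g) ^+ 2 * B g g
  = (B f f * B g g - B f g ^+ 2) / B g g by field.
by rewrite pmulr_lge0 ?invr_gt0// subr_ge0.
Qed.

(** Null vectors are orthogonal to everything, so equality modulo null vectors can be used inside
    [B]. *)
Lemma form_eq0l f g : D f -> D g -> B f f = 0 -> B f g = 0.
Proof.
move=> Df Dg f0; have := form_cauchy_schwarz Df Dg.
by rewrite f0 mul0r => h; apply/eqP; rewrite -sqrf_eq0 eq_le h sqr_ge0.
Qed.

(** Coercivity bounds [B (f - g) (f - g)] by [B (P (f - g)) (f - g)]. Moving [P] across and back
    splits this into [B (P f - P g) (f - g)], which vanishes because [P f - P g] is null. *)
Lemma coercive_inj P f g : form_selfadjoint D B P ->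
  (forall f, D f -> B f f <= B (P f) f) -> D f -> D g ->
  B (P f - P g) (P f - P g) = 0 -> B (f - g) (f - g) = 0.
Proof.
move=> [DP adjP] coerc Df Dg e; apply/eqP.
have Dfg : D (f - g) by apply: DB.
have DPfg : D (P f - P g) by apply: DB; apply: DP.
rewrite eq_le (hilbert_form_ge0 H)// andbT (le_trans (coerc _ Dfg))//.
rewrite adjP// formBl// -?adjP//; try by apply: DP.
by rewrite -formBl ?(form_eq0l _ _ e)//; apply: DP.
Qed.

(* Lax-Milgram by Richardson iteration: [f - P f / L1] contracts the norm. *)
Lemma coercive_surj P (L : R) g : form_selfadjoint D B P ->
  (forall f, D f -> B f f <= B (P f) f) ->
  (forall f, D f -> B (P f) (P f) <= L * B f f) -> D g ->
  exists2 f, D f & B (P f - g) (P f - g) = 0.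
Proof.
move=> [DP adjP] coerc bnd Dg.
(* [L1] exceeds 1 and dominates [L], so the step size [c = 1 / L1] and the contraction factor
   [1 - c] both lie strictly between 0 and 1. *)
pose L1 := `|L| + 2.
have L1_gt1 : 1 < L1 by rewrite /L1; have := normr_ge0 L; lra.
have LL1 : L <= L1 by rewrite /L1; have := ler_norm L; lra.
pose c := L1^-1.
have c0 : 0 < c by rewrite invr_gt0; lra.
have c1 : c < 1 by rewrite invf_lt1//; lra.
have cL1 : c * L1 = 1 by rewrite mulVf//; lra.
pose w := Num.sqrt (1 - c).
have w2 : w ^+ 2 = 1 - c by rewrite sqr_sqrtr//; lra.
have w0 : 0 < w by rewrite sqrtr_gt0; lra.
have w1 : w < 1 by rewrite -sqrtr1 ltr_sqrt; lra.
have w01 : 0 < w < 1 by rewrite w0.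
pose step f := f - c%:C%C *: P f.
have Dstep f : D f -> D (step f) by move=> Df; apply: DB => //; apply/DZ/DP.
(* The left side is [q - 2 c b + c^2 a] with [b >= q] and [a <= L1 q]; since [c L1 = 1], it is at
   most [q - 2 c q + c q]. *)
have contr f : D f -> B (step f) (step f) <= (1 - c) * B f f.
  move=> Df; have DPf := DP _ Df; have DcPf := DZ c%:C%C DPf.
  rewrite /step formBl ?formBr ?formZl ?formZr//; last exact: DB.
  rewrite (BC f); have := coerc _ Df; have := bnd _ Df.
  have q0 := hilbert_form_ge0 H Df.
  have : L * B f f <= L1 * B f f by exact: ler_wpM2r.
  set a := B (P f) (P f); set b := B (P f) f; set q := B f f => h1 h2 h3.
  have : c * (c * a) <= c * (c * (L1 * q)).
    by do 2 apply: ler_wpM2l (ltW c0) _ _ _; lra.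
  rewrite [c * (L1 * q)]mulrA cL1 mul1r.
  have := ler_wpM2l (ltW c0) h3; lra.
(* [res n] is the residual, up to null vectors, of the n-th iterate [\sum_(k < n) u k], where
   [u k = c res k] is the correction made at stage [k]. *)
pose res n := iter n step g.
have Dres n : D (res n) by elim: n => //= n; exact: Dstep.
have qres n : B (res n) (res n) <= B g g * (w ^+ n) ^+ 2.
  elim: n => [|n IH]; first by rewrite expr0 expr1n mulr1.
  apply: le_trans (contr _ (Dres n)) _.
  rewrite [w ^+ n.+1]exprS exprMn w2 [leRHS]mulrCA ler_wpM2l//; lra.
pose u n := c%:C%C *: res n.
have Du n : D (u n) by apply: DZ.
have [|f Df [K fK]] := hilbert_form_complete H (K := c ^+ 2 * B g g) Du w01.
  move=> n; rewrite formZl ?formZr// mulrA -expr2 -[leRHS]mulrA.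
  by rewrite ler_wpM2l ?sqr_ge0.
exists f => //; set e := P f - g.
have De : D e by apply: DB => //; exact: DP.
(* This is [P (\sum_(k < n) u k) = g - res n] tested against [e], with [P] moved onto [e]; it
   telescopes because [c P (res k) = res k - res k.+1]. *)
have weak n : B (\sum_(k < n) u k) (P e) = B g e - B (res n) e.
  elim: n => [|n IH]; first by rewrite big_ord0 form0l ?subrr//; apply: DP.
  rewrite big_ord_recr/= formDl ?IH//; [|exact: Dsum|exact: DP].
  rewrite formZl//; last exact: DP.
  by rewrite -adjP// /step formBl ?formZl//; [ring|exact: DP|exact/DZ/DP].
(* [B e e] is a difference of two terms, one small because the iterates approach [f], the other
   because the residuals decay. Cauchy-Schwarz and [(x - y)^2 <= 2 x^2 + 2 y^2] give the bound. *)
have key n : B e e ^+ 2 <= (2 * K * B (P e) (P e) + 2 * B g g * B e e) * w ^+ n.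
  have Ds : D (\sum_(k < n) u k) by exact: Dsum.
  have Dfs : D (f - \sum_(k < n) u k) by exact: DB.
  have DPe := DP _ De.
  have {1}-> : B e e = B (f - \sum_(k < n) u k) (P e) - B (res n) e.
    have -> : B e e = B f (P e) - B g e.
      by rewrite -adjP// -formBl//; exact: DP.
    by rewrite formBl// weak; ring.
  have cs1 := form_cauchy_schwarz Dfs DPe.
  have cs2 := form_cauchy_schwarz (Dres n) De.
  have h1 := ler_wpM2r (hilbert_form_ge0 H DPe) (fK n).
  have h2 := ler_wpM2r (hilbert_form_ge0 H De) (qres n).
  (* One factor [w ^+ n] is given up so that both terms decay at the same rate. *)
  have h3 : B g g * (w ^+ n) ^+ 2 * B e e <= B g g * w ^+ n * B e e.
    rewrite ler_wpM2r ?(hilbert_form_ge0 H)// ler_wpM2l ?(hilbert_form_ge0 H)//.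
    by rewrite expr2 ler_piMr ?exprn_ge0 ?exprn_ile1// ltW.
  have cs1' := le_trans cs1 h1; have cs2' := le_trans cs2 (le_trans h2 h3).
  move: cs1' cs2'; set x := B _ (P e); set y := B (res n) e => xle yle.
  apply: (@le_trans _ _ (2 * x ^+ 2 + 2 * y ^+ 2)).
    rewrite -subr_ge0.
    have -> : 2 * x ^+ 2 + 2 * y ^+ 2 - (x - y) ^+ 2 = (x + y) ^+ 2 by ring.
    exact: sqr_ge0.
  rewrite [leRHS]mulrDl lerD//.
    by rewrite -!mulrA ler_pM2l// [B _ _ * w ^+ n]mulrC mulrA.
  by rewrite -!mulrA ler_pM2l// [B e e * w ^+ n]mulrC mulrA.
have := le0_of_le_geometric w01 key => e0.
by apply/eqP; rewrite -sqrf_eq0 eq_le e0 sqr_ge0.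
Qed.

(* F. Riesz: S (1 - S) = S (1 - S) S + (1 - S) S (1 - S). *)
Lemma riesz_step S : form_selfadjoint D B S -> form_ge0 D B S ->
  (forall f, D f -> B (S f) f <= B f f) ->
  forall f, D f -> B (S f) (S f) <= B (S f) f.
Proof.
move=> [DS adjS] S0 S1 f Df.
have DSf := DS _ Df; have DSSf := DS _ DSf; have Dd := DB Df DSf.
have SdE g : D g -> B (S (f - S f)) g = B (S f) g - B (S (S f)) g.
  move=> Dg; have DSg := DS _ Dg.
  by rewrite adjS// formBl// (adjS (S f) g)// (adjS f g).
have := S0 _ Dd; rewrite SdE// !formBr//.
rewrite (adjS (S f) f)//; have := S1 _ DSf; lra.
Qed.

Fixpoint riesz_seq (S : V -> V) n : V -> V :=
  if n is n'.+1 then fun f => riesz_seq S n' f - riesz_seq S n' (riesz_seq S n' f)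
  else S.

(** The lower bound is [riesz_step], that is [S_n^2 <= S_n]; the upper bound persists because each
    step subtracts the positive square [S_n^2]. *)
Lemma riesz_seqP S n : form_selfadjoint D B S -> form_ge0 D B S ->
  (forall f, D f -> B (S f) f <= B f f) ->
  [/\ form_selfadjoint D B (riesz_seq S n), form_ge0 D B (riesz_seq S n) &
      forall f, D f -> B (riesz_seq S n f) f <= B f f].
Proof.
move=> adjS S0 S1; elim: n => [//|n [adjn n0 n1]].
have [Dn an] := adjn; set A := riesz_seq S n in adjn n0 n1 Dn an *.
have expand f g : D f -> D g -> B (A f - A (A f)) g = B (A f) g - B (A f) (A g).
  move=> Df Dg; have DAf := Dn _ Df; have DAAf := Dn _ DAf.
  by rewrite formBl// (an (A f) g).
split => /=; rewrite -/A.
- split => [f Df|f g Df Dg].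
    by have DAf := Dn _ Df; apply: DB => //; exact: Dn.
  by rewrite expand// [RHS]BC expand// (an f g)// (BC f (A g)) (BC (A f) (A g)).
- move=> f Df; rewrite expand// subr_ge0; exact: riesz_step.
- move=> f Df; rewrite expand//; apply: le_trans (n1 _ Df).
  by rewrite gerBl (hilbert_form_ge0 H)//; exact: Dn.
Qed.

(** Commutation is stated weakly because [T S f] and [S T f] agree only up to null vectors. For the
    square, the induction hypothesis is used twice, the second time with the outer factor moved onto
    [g]. *)
Lemma riesz_seq_commute T S n : form_selfadjoint D B T -> form_selfadjoint D B S ->
  form_ge0 D B S -> (forall f, D f -> B (S f) f <= B f f) ->
  (forall f g, D f -> D g -> B (T (S f)) g = B (S (T f)) g) ->
  forall f g, D f -> D g ->
  B (T (riesz_seq S n f)) g = B (riesz_seq S n (T f)) g.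
Proof.
move=> [DT aT] adjS S0 S1 TS; elim: n => [//|n IH] f g Df Dg /=.
have [[Dn an] _ _] := riesz_seqP n adjS S0 S1.
set A := riesz_seq S n in Dn an IH *.
have DAf := Dn _ Df; have DAAf := Dn _ DAf; have DTf := DT _ Df.
have DATf := Dn _ DTf; have DTg := DT _ Dg; have DAg := Dn _ Dg.
have DTAf := DT _ DAf; have DAATf := Dn _ DATf; have DAf' := DB DAf DAAf.
rewrite aT// !formBl// -!aT// !IH//.
by rewrite (an (T (A f)))// IH// -(an (A (T f))).
Qed.

Lemma contraction_product_ge0 T S :
  form_selfadjoint D B T -> form_ge0 D B T ->
  form_selfadjoint D B S -> form_ge0 D B S ->
  (forall f, D f -> B (S f) f <= B f f) ->
  (forall f g, D f -> D g -> B (T (S f)) g = B (S (T f)) g) ->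
  form_ge0 D B (T \o S).
Proof.
move=> adjT T0 adjS S0 S1 TS f Df /=.
have [DT aT] := adjT.
pose A := riesz_seq S.
have P n := riesz_seqP n adjS S0 S1.
have DA n g : D g -> D (A n g) by have [[+ _] _ _] := P n; exact.
have aA n : forall g h, D g -> D h -> B (A n g) h = B g (A n h).
  by have [[_ +] _ _] := P n.
have DTf := DT _ Df.
have tele n h : D h -> B (S f) h = \sum_(k < n) B (A k (A k f)) h + B (A n f) h.
  move=> Dh; elim: n => [|n ->]; first by rewrite big_ord0 add0r.
  rewrite big_ord_recr/= formBl//; first by rewrite -/(A n); ring.
  - exact: DA.
  - by do 2 apply: (DA n).
have sum_le n : \sum_(k < n) B (A k f) (A k f) <= B (S f) f.
  rewrite (tele n f Df) -[leLHS]addr0 lerD//; last by have [_ + _] := P n; exact.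
  by apply: ler_sum => k _; rewrite [leRHS]aA//; exact: DA.
(* In the telescoped sum tested against [T f], each term equals [B (T (A k f)) (A k f)], which is
   nonnegative. *)
have low n : B (A n f) (T f) <= B (T (S f)) f.
  rewrite aT//; last by exact: (DA 0%N).
  rewrite (tele n _ DTf) lerDr; apply: sumr_ge0 => k _.
  have DAf := DA k _ Df.
  rewrite aA// BC -(riesz_seq_commute k adjT adjS S0 S1 TS Df DAf).
  exact: T0.
rewrite leNgt; apply/negP => neg.
set a := B (T (S f)) f in low neg.
(* As [a < 0], [low] puts [B (A n f) (T f)] at or below [a], so its square is at least [a ^+ 2].
   Every [B (A n f) (A n f)] is thus bounded below uniformly, against the summability in
   [sum_le]. *)
have cs n : a ^+ 2 <= B (A n f) (A n f) * B (T f) (T f).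
  apply: le_trans (form_cauchy_schwarz (DA n _ Df) DTf).
  by have := low n; nra.
have bnd n : n%:R * a ^+ 2 <= B (S f) f * B (T f) (T f).
  apply: (@le_trans _ _ (\sum_(k < n) (B (A k f) (A k f) * B (T f) (T f)))).
    rewrite mulr_natl -[n in _ *+ n]card_ord -sumr_const.
    exact: ler_sum.
  by rewrite -mulr_suml ler_wpM2r// (hilbert_form_ge0 H).
have a2 : 0 < a ^+ 2 by rewrite exprn_even_gt0//= lt_eqF.
(* The first natural number above the ratio that [bnd] imposes as an upper bound. *)
have := bnd (Num.truncn (B (S f) f * B (T f) (T f) / a ^+ 2)).+1.
rewrite -ler_pdivlMr// leNgt => /negP; apply.
exact: truncnS_gt.
Qed.

Lemma commuting_product_ge0 T S (K : R) :
  form_selfadjoint D B T -> form_ge0 D B T ->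
  form_selfadjoint D B S -> form_ge0 D B S ->
  (forall f, D f -> B (S f) (S f) <= K * B f f) ->
  (forall f g, D f -> D g -> B (T (S f)) g = B (S (T f)) g) ->
  form_ge0 D B (T \o S).
Proof.
move=> adjT T0 [DS aS] S0 SK TS.
have [DT aT] := adjT.
pose M := `|K| + 1; pose c := M^-1.
have M0 : 0 < M by rewrite ltr_wpDl.
have c0 : 0 < c by rewrite invr_gt0.
pose S' f := c%:C%C *: S f.
have Tc f g : D f -> D g -> B (T (S' f)) g = c * B (T (S f)) g.
  move=> Df Dg; have DSf := DS _ Df; have DTg := DT _ Dg.
  by rewrite aT ?formZl -?aT//; exact: DZ.
have : form_ge0 D B (T \o S').
  apply: contraction_product_ge0 => //.
  - split=> [f Df|f g Df Dg]; first exact/DZ/DS.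
    by rewrite /S' formZl ?formZr ?aS//; exact: DS.
  - move=> f Df; rewrite /S' formZl//; last exact: DS.
    by rewrite mulr_ge0 ?S0// ltW.
  - move=> f Df; have DSf := DS _ Df; rewrite /S' formZl//.
    rewrite mulrC ler_pdivrMr// mulrC.
    (* Expanding the square of [S f - f] gives [2 B (S f) f <= (K + 1) B f f], hence
       [B (S f) f <= M B f f]. *)
    have := hilbert_form_ge0 H (DB DSf Df).
    rewrite formBl ?formBr//; last exact: DB.
    have q0 := hilbert_form_ge0 H Df.
    have := ler_wpM2r q0 (ler_norm K); have := mulr_ge0 (normr_ge0 K) q0.
    rewrite (BC f) /M; have := SK _ Df; lra.
  - move=> f g Df Dg; rewrite Tc// formZl//; last exact/DS/DT.
    by rewrite TS.
move=> TS' f Df; have := TS' f Df; rewrite /= Tc// pmulr_rge0//.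
Qed.

End HilbertForm.

(** * Completeness of real L^2 along geometric series *)

Section WeightedSums.
Variables (R : realType) (w : R).
Hypothesis w01 : 0 < w < 1.

Let w0 : 0 < w. Proof. by case/andP: w01. Qed.
Let w1 : 0 < 1 - w. Proof. by rewrite subr_gt0; case/andP: w01. Qed.
Let wn0 n : 0 < w ^+ n. Proof. exact: exprn_gt0. Qed.

Lemma sum_geometric_le n : \sum_(k < n) w ^+ k <= (1 - w)^-1.
Proof.
rewrite -[leRHS]mul1r ler_pdivlMr// mulrC -[X in X * _]opprB mulNr -subrX1.
by rewrite opprB gerBl ltW.
Qed.

(* Cauchy-Schwarz with weights [w ^+ k], using
   [(x + y)^2 <= x^2 / (1 - w) + y^2 / w] at each step. *)
Lemma sqr_sum_le_weighted (a : nat -> R) n m :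
  (\sum_(k < m) a (n + k)%N) ^+ 2 <=
  w ^+ n / (1 - w) * \sum_(k < m) (a (n + k)%N ^+ 2 / w ^+ (n + k)).
Proof.
elim: m n => [|m IH] n; first by rewrite !big_ord0 expr0n mulr0.
rewrite !big_ord_recl addn0.
have bmp (F : nat -> R) : \sum_(i < m) F (n + bump 0 i)%N = \sum_(i < m) F (n.+1 + i)%N.
  by apply: eq_bigr => i _; rewrite /bump leq0n addnA addn1.
rewrite (bmp a) (bmp (fun k => a k ^+ 2 / w ^+ k)).
have := IH n.+1; set A := \sum_(i < m) _; set Q := \sum_(i < m) _ => h.
have s : (a n + A) ^+ 2 <= a n ^+ 2 / (1 - w) + A ^+ 2 / w.
  rewrite -subr_ge0.
  have -> : a n ^+ 2 / (1 - w) + A ^+ 2 / w - (a n + A) ^+ 2 =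
     (w * a n - (1 - w) * A) ^+ 2 / (w * (1 - w)) by field; rewrite !gt_eqF.
  by rewrite divr_ge0 ?sqr_ge0// mulr_ge0// ltW.
apply: le_trans s _.
have -> : w ^+ n / (1 - w) * (a n ^+ 2 / w ^+ n + Q) =
   a n ^+ 2 / (1 - w) + (w ^+ n.+1 / (1 - w) * Q) / w.
  by rewrite [w ^+ n.+1]exprS; field; rewrite !gt_eqF.
by rewrite lerD2l ler_pM2r ?invr_gt0.
Qed.

(** Absolute convergence comes from [|a_k| <= w^k + a_k^2 / w^k]; the error bound is the limit of
    the weighted Cauchy-Schwarz estimate for finite blocks. *)
Lemma weighted_series_cvg (a : nat -> R) (M : R) :
  (forall n, \sum_(k < n) (a k ^+ 2 / w ^+ k) <= M) ->
  exists2 l, (fun n => \sum_(k < n) a k) @ \oo --> l &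
    forall n, (l - \sum_(k < n) a k) ^+ 2 <= w ^+ n / (1 - w) * M.
Proof.
move=> aM.
have aM' n m : \sum_(k < m) (a (n + k)%N ^+ 2 / w ^+ (n + k)) <= M.
  apply: le_trans (aM (n + m)%N).
  rewrite big_split_ord/= lerDr sumr_ge0// => i _.
  by rewrite divr_ge0 ?sqr_ge0// ltW.
have cv : cvgn (series a).
  apply: normed_cvg; apply: nondecreasing_is_cvgn.
    by apply: nondecreasing_series => k _ _; exact: normr_ge0.
  exists ((1 - w)^-1 + M) => _ [n _ <-].
  rewrite /normed_series_of /series/= big_mkord.
  apply: (@le_trans _ _ (\sum_(k < n) (w ^+ k + a k ^+ 2 / w ^+ k))).
    apply: ler_sum => k _; rewrite -real_normK ?num_real//.
    rewrite -subr_ge0.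
    have -> : w ^+ k + `|a k| ^+ 2 / w ^+ k - `|a k| =
      ((w ^+ k - `|a k| / 2) ^+ 2 + 3 / 4 * `|a k| ^+ 2) / w ^+ k.
      by field; rewrite gt_eqF.
    apply: divr_ge0 (ltW _) => //; apply: addr_ge0; first exact: sqr_ge0.
    by apply: mulr_ge0; [lra|exact: sqr_ge0].
  by rewrite big_split lerD// sum_geometric_le.
have sE : series a = (fun n => \sum_(k < n) a k).
  by apply/funext => n; rewrite /series/= big_mkord.
rewrite sE in cv; exists (limn (fun n => \sum_(k < n) a k)) => // n.
set l := limn _.
have cvl : (fun m => (\sum_(k < m) a k - \sum_(k < n) a k) ^+ 2) @ \oo -->
           (l - \sum_(k < n) a k) ^+ 2.
  rewrite expr2; under eq_fun do rewrite expr2.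
  by apply: cvgM; apply: cvgB => //; exact: cvg_cst.
rewrite -(cvg_lim _ cvl)//; apply: limr_le; first by apply/cvg_ex; eexists; exact: cvl.
exists n => // m /= nm.
rewrite -(subnKC nm) big_split_ord/= addrAC subrr add0r.
apply: le_trans (sqr_sum_le_weighted _ _ _) _.
by rewrite ler_wpM2l// divr_ge0// ltW.
Qed.

End WeightedSums.

(** * Square-integrable real functions and a Riesz-Fischer theorem *)

Section SquareIntegrable.
Context d (T : measurableType d) (R : realType).
Variable mu : {measure set T -> \bar R}.
Implicit Types u v : T -> R.

Definition square_integrable u : Prop :=
  measurable_fun setT u /\ (\int[mu]_x (u x ^+ 2)%:E < +oo)%E.

Lemma square_integrable_mul u v : square_integrable u -> square_integrable v ->
  mu.-integrable setT (EFin \o (fun x => u x * v x)).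
Proof.
move=> [mu_ iu] [mv iv].
have msq (f : T -> R) :
    measurable_fun setT f -> measurable_fun setT (fun x => f x ^+ 2).
  by exact: measurable_funX.
apply/integrableP; split; first by apply/measurable_EFinP; exact: measurable_funM.
apply: (@le_lt_trans _ _ (\int[mu]_x ((u x ^+ 2)%:E + (v x ^+ 2)%:E))%E).
  apply: ge0_le_integral => //.
  - apply: measurableT_comp => //; apply/measurable_EFinP; exact: measurable_funM.
  - by apply: emeasurable_funD; apply/measurable_EFinP; exact: msq.
  - move=> x _; rewrite /= -EFinD lee_fin normrM.
    rewrite -(real_normK (num_real (u x))) -(real_normK (num_real (v x))).
    have := sqr_ge0 (`|u x| - `|v x|).
    by have := normr_ge0 (u x); have := normr_ge0 (v x); nra.
rewrite ge0_integralD//; last 4 first.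
- by move=> x _; rewrite lee_fin sqr_ge0.
- by apply/measurable_EFinP; exact: msq.
- by move=> x _; rewrite lee_fin sqr_ge0.
- by apply/measurable_EFinP; exact: msq.
exact: lte_add_pinfty.
Qed.

Lemma integrable_mulD u1 v1 u2 v2 :
  square_integrable u1 -> square_integrable v1 ->
  square_integrable u2 -> square_integrable v2 ->
  mu.-integrable setT (EFin \o (fun x => u1 x * v1 x + u2 x * v2 x)).
Proof.
move=> su1 sv1 su2 sv2.
have := integrableD measurableT (square_integrable_mul su1 sv1)
  (square_integrable_mul su2 sv2).
by congr (_.-integrable _ _).
Qed.

Lemma square_integrable_sqr u : measurable_fun setT u ->
  mu.-integrable setT (EFin \o (fun x => u x ^+ 2)) -> square_integrable u.
Proof.
move=> mu_ /integrableP[_ iu]; split => //.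
apply: le_lt_trans iu; rewrite le_eqVlt; apply/orP; left; apply/eqP.
by apply: eq_integral => x _; rewrite /= ger0_norm ?sqr_ge0.
Qed.

Lemma square_integrable_linear a u v : square_integrable u -> square_integrable v ->
  square_integrable (fun x => a * u x + v x).
Proof.
move=> su sv; have [[mu_ _] [mv _]] := (su, sv).
apply: square_integrable_sqr.
  by apply: measurable_funD => //; exact: measurable_funM.
have -> : EFin \o (fun x => (a * u x + v x) ^+ 2) =
   (fun x => (a ^+ 2)%:E * (u x * u x)%:E +
      ((2 * a)%:E * (u x * v x)%:E + (v x * v x)%:E))%E.
  by apply/funext => x; rewrite /= -!EFinM -!EFinD; congr EFin; ring.
apply: integrableD => //.
  by apply: integrableZl => //; exact: square_integrable_mul.
apply: integrableD => //; last exact: square_integrable_mul.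
by apply: integrableZl => //; exact: square_integrable_mul.
Qed.

Lemma square_integrable0 : square_integrable (fun=> 0).
Proof. by split => //; rewrite expr0n integral0. Qed.

Lemma square_integrable_sum n (u : nat -> T -> R) :
  (forall k, square_integrable (u k)) ->
  square_integrable (fun x => \sum_(k < n) u k x).
Proof.
move=> su; elim: n => [|n IH].
  by under eq_fun do rewrite big_ord0; exact: square_integrable0.
have := square_integrable_linear 1 (su n) IH.
by under eq_fun do rewrite mul1r addrC -[_ + _](big_ord_recr n (fun k => u k _)).
Qed.

(** Half of the decay [w^(2 n)] pays for the weights: [u_k^2 / w^k] still has integral at most
    [K w^k], which is summable. The other half is the rate in the conclusion. *)
Theorem riesz_fischer_geometric (u : nat -> T -> R) (K w : R) : 0 < w < 1 ->
  (forall n, square_integrable (u n)) ->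
  (forall n, \int[mu]_x (u n x ^+ 2) <= K * (w ^+ n) ^+ 2) ->
  exists2 v, square_integrable v & exists L, forall n,
    \int[mu]_x ((v x - \sum_(k < n) u k x) ^+ 2) <= L * w ^+ n.
Proof.
move=> w01 su uK; have [w0 w1] := andP w01.
have wn0 n : 0 < w ^+ n by exact: exprn_gt0.
have K0 : 0 <= K.
  have := uK 0%N; rewrite expr0 expr1n mulr1; apply: le_trans.
  by apply: Rintegral_ge0 => x _; exact: sqr_ge0.
pose h k x : \bar R := (u k x ^+ 2 / w ^+ k)%:E.
have h0 k x : (0 <= h k x)%E by rewrite lee_fin divr_ge0 ?sqr_ge0// ltW.
have mh k : measurable_fun setT (h k).
  apply/measurable_EFinP; apply: measurable_funM => //; apply: measurable_funX.
  by case: (su k).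
pose H x : \bar R := (\sum_(k <oo) h k x)%E.
have H0 x : (0 <= H x)%E by apply: nneseries_ge0.
have mH : measurable_fun setT H by apply: ge0_emeasurable_sum.
have ih k : (\int[mu]_x h k x <= (K * w ^+ k)%:E)%E.
  rewrite /h; under eq_integral do rewrite mulrC EFinM.
  rewrite ge0_integralZl//; last 3 first.
  - by apply/measurable_EFinP; apply: measurable_funX; case: (su k).
  - by move=> x _; rewrite lee_fin sqr_ge0.
  - by rewrite lee_fin invr_ge0 ltW.
  have fi : (\int[mu]_x (u k x ^+ 2)%:E)%E \is a fin_num.
    rewrite ge0_fin_numE; first by case: (su k).
    by apply: integral_ge0 => x _; rewrite lee_fin sqr_ge0.
  rewrite -(fineK fi) -EFinM lee_fin mulrC ler_pdivrMr//.
  by rewrite -mulrA -expr2; exact: uK.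
have partial_le x n : (\sum_(k < n) h k x <= H x)%E.
  by rewrite -(big_mkord xpredT (h ^~ x)); apply: nneseries_lim_ge.
have iH : (\int[mu]_x H x <= (K / (1 - w))%:E)%E.
  rewrite integral_nneseries//; apply: lime_le.
    by apply: is_cvg_nneseries => n _ _; exact: integral_ge0.
  apply: nearW => n; rewrite big_mkord.
  apply: (@le_trans _ _ (\sum_(k < n) (K * w ^+ k)%:E)%E).
    by apply: lee_sum => k _; exact: ih.
  by rewrite sumEFin lee_fin -mulr_sumr ler_wpM2l// sum_geometric_le.
(* The upper limit is measurable and defined everywhere; it is the sum of the series wherever [H x]
   is finite. *)
pose v x := fine (limn_esup (fun n => (\sum_(k < n) u k x)%:E)).
have mv : measurable_fun setT v.
  apply: measurableT_comp; first exact: fine_measurable.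
  apply: measurable_fun_limn_esup => n; apply/measurable_EFinP.
  by have [] := square_integrable_sum n su.
(* Where [H x] is infinite the bound is trivial, so no exceptional null set has to be removed. *)
have vH n x : (((v x - \sum_(k < n) u k x) ^+ 2)%:E <=
               (w ^+ n / (1 - w))%:E * H x)%E.
  have c0 : 0 < w ^+ n / (1 - w) by rewrite divr_gt0// subr_gt0.
  have [Hoo|] := eqVneq (H x) +oo%E; first by rewrite Hoo gt0_muley ?lte_fin ?leey.
  rewrite -ltey -ge0_fin_numE// => Hfin.
  have [|l cvl lle] := @weighted_series_cvg _ _ w01 (u ^~ x) (fine (H x)).
    by move=> m; rewrite -lee_fin fineK// -sumEFin; exact: partial_le.
  have -> : v x = l.
    have cvE : (fun n => (\sum_(k < n) u k x)%:E) @ \oo --> l%:E.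
      by apply: cvg_EFin; [exact: nearW|exact: cvl].
    by rewrite /v (cvg_limn_einf_sup cvE).2.
  by rewrite -(fineK Hfin) -EFinM lee_fin.
have ivn n : (\int[mu]_x ((v x - \sum_(k < n) u k x) ^+ 2)%:E <=
     (w ^+ n / (1 - w) * (K / (1 - w)))%:E)%E.
  apply: (@le_trans _ _ (\int[mu]_x ((w ^+ n / (1 - w))%:E * H x))%E).
    apply: ge0_le_integral => //.
    - by move=> x _; rewrite lee_fin sqr_ge0.
    - apply/measurable_EFinP; apply: measurable_funX; apply: measurable_funB => //.
      by have [] := square_integrable_sum n su.
    - exact: measurable_funeM.
  have c0 : 0 <= w ^+ n / (1 - w) by rewrite divr_ge0 ?ltW// subr_gt0.
  by rewrite ge0_integralZl// [leRHS]EFinM lee_wpmul2l.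
exists v.
  (* The error bound with the empty sum says that [v] itself has finite square integral. *)
  split => //; have := ivn 0%N; under eq_integral do rewrite big_ord0 subr0.
  by move=> /le_lt_trans; apply; exact: ltry.
exists (K / (1 - w) ^+ 2) => n.
have -> : K / (1 - w) ^+ 2 * w ^+ n = w ^+ n / (1 - w) * (K / (1 - w)).
  by field; rewrite gt_eqF// subr_gt0.
rewrite -lee_fin fineK//.
rewrite ge0_fin_numE; first by rewrite (le_lt_trans (ivn n)) ?ltry.
by apply: integral_ge0 => x _; rewrite lee_fin sqr_ge0.
Qed.

End SquareIntegrable.

(** * The space L^2(G, C^(s x r)) *)

Section ComplexParts.
Variable R : realType.
Implicit Types z w : R[i].

Lemma ReD z w : complex.Re (z + w) = complex.Re z + complex.Re w.
Proof. by case: z; case: w. Qed.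

Lemma ImD z w : complex.Im (z + w) = complex.Im z + complex.Im w.
Proof. by case: z; case: w. Qed.

Lemma ReB z w : complex.Re (z - w) = complex.Re z - complex.Re w.
Proof. by case: z; case: w. Qed.

Lemma ImB z w : complex.Im (z - w) = complex.Im z - complex.Im w.
Proof. by case: z; case: w. Qed.

Lemma ReM z w :
  complex.Re (z * w) = complex.Re z * complex.Re w - complex.Im z * complex.Im w.
Proof. by case: z; case: w. Qed.

Lemma ImM z w :
  complex.Im (z * w) = complex.Re z * complex.Im w + complex.Im z * complex.Re w.
Proof. by case: z; case: w. Qed.

Lemma Re_sum I (r : seq I) (P : pred I) (F : I -> R[i]) :
  complex.Re (\sum_(i <- r | P i) F i) = \sum_(i <- r | P i) complex.Re (F i).
Proof. exact: (big_morph _ ReD). Qed.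

Lemma Im_sum I (r : seq I) (P : pred I) (F : I -> R[i]) :
  complex.Im (\sum_(i <- r | P i) F i) = \sum_(i <- r | P i) complex.Im (F i).
Proof. exact: (big_morph _ ImD). Qed.

Lemma Re_mul_conj z w : complex.Re (z * w^*) =
  complex.Re z * complex.Re w + complex.Im z * complex.Im w.
Proof. by case: z => a b; case: w => c d /=; ring. Qed.

Lemma Im_mul_conj z w : complex.Im (z * w^*) =
  complex.Im z * complex.Re w - complex.Re z * complex.Im w.
Proof. by case: z => a b; case: w => c d /=; ring. Qed.

Lemma complex_eq z w :
  complex.Re z = complex.Re w -> complex.Im z = complex.Im w -> z = w.
Proof. by case: z => a b; case: w => c d /= -> ->. Qed.

End ComplexParts.

Section MatrixL2.
Variables (R : realType) (G : topologicalZmodType).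
Variables (mu : {measure set (borel G) -> \bar R}) (s r : nat).
Local Notation Fn := (G -> 'M[R[i]]_(s, r)).
Local Notation L2 := (@is_L2 R G mu s r).
Local Notation sqint := (@square_integrable _ (borel G) R mu).
Implicit Types (f g h : Fn) (U : Fn -> Fn).

(** Gives access to the real theory entry by entry: each squared part is at most [csq], and [csq] is
    the sum of the two. *)
Lemma is_L2P f : L2 f <-> forall i j,
  sqint (fun x => complex.Re (f x i j)) /\ sqint (fun x => complex.Im (f x i j)).
Proof.
split=> Lf i j; last first.
  have [sR sI] := Lf i j; have [[mR _] [mI _]] := (sR, sI); split => //.
  have : mu.-integrable setT (EFin \o (fun x : borel G =>
      complex.Re (f x i j) * complex.Re (f x i j) +
      complex.Im (f x i j) * complex.Im (f x i j))).
    exact: integrable_mulD.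
  move=> /integrableP[_]; apply: le_lt_trans.
  rewrite le_eqVlt; apply/orP; left; apply/eqP; apply: eq_integral => x _.
  by rewrite /csq /= !expr2 ger0_norm// addr_ge0// -expr2 sqr_ge0.
have [mR mI fin] := Lf i j.
have mcsq : measurable_fun setT (fun x : borel G => csq (f x i j)).
  by apply: measurable_funD; apply: measurable_funX.
split; split => //; apply: le_lt_trans fin; apply: ge0_le_integral => //.
- by move=> x _; rewrite lee_fin sqr_ge0.
- by apply/measurable_EFinP; exact: measurable_funX.
- exact/measurable_EFinP.
- by move=> x _; rewrite lee_fin lerDl sqr_ge0.
- by move=> x _; rewrite lee_fin sqr_ge0.
- by apply/measurable_EFinP; exact: measurable_funX.
- exact/measurable_EFinP.
- by move=> x _; rewrite lee_fin lerDr sqr_ge0.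
Qed.

(** The real part suffices for the form results: it determines [fnorm] and [l2eq], and it inherits
    self-adjointness and positivity of operators. *)
Definition re_hip f g : R := complex.Re (hip mu f g).

Lemma re_hipE f g : re_hip f g = \sum_(i < s) \sum_(j < r) \int[mu]_x
  (complex.Re (f x i j) * complex.Re (g x i j) +
   complex.Im (f x i j) * complex.Im (g x i j)).
Proof.
rewrite /re_hip /hip /mxtrace Re_sum; apply: eq_bigr => i _.
rewrite mxE Re_sum; apply: eq_bigr => j _ /=.
by apply: eq_Rintegral => x _; rewrite Re_mul_conj.
Qed.

Lemma re_hip_sqr f : re_hip f f =
  \sum_(i < s) \sum_(j < r) \int[mu]_x csq (f x i j).
Proof. by rewrite re_hipE. Qed.

Lemma re_hip_ge0 f : 0 <= re_hip f f.
Proof.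
rewrite re_hip_sqr; apply: sumr_ge0 => i _; apply: sumr_ge0 => j _.
by apply: Rintegral_ge0 => x _; rewrite addr_ge0// sqr_ge0.
Qed.

Lemma fnormE f : fnorm mu f = Num.sqrt (re_hip f f).
Proof. by rewrite re_hip_sqr. Qed.

Lemma l2eqE f g : l2eq mu f g <-> re_hip (f - g) (f - g) = 0.
Proof.
rewrite /l2eq (fnormE (f - g)); split => [/eqP|].
  by rewrite sqrtr_eq0 => h; apply/eqP; rewrite eq_le h re_hip_ge0.
by move=> ->; rewrite sqrtr0.
Qed.

Lemma is_L2_linear (a : R[i]) f g : L2 f -> L2 g -> L2 (a *: f + g).
Proof.
move=> /is_L2P Lf /is_L2P Lg; apply/is_L2P => i j.
have [fR fI] := Lf i j; have [gR gI] := Lg i j; split.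
  have := square_integrable_linear (complex.Re a) fR
    (square_integrable_linear (- complex.Im a) fI gR).
  by congr sqint; apply/funext => x; rewrite !mxE ReD ReM; ring.
have := square_integrable_linear (complex.Re a) fI
  (square_integrable_linear (complex.Im a) fR gI).
by congr sqint; apply/funext => x; rewrite !mxE ImD ImM; ring.
Qed.

Lemma is_L2_0 : L2 0.
Proof.
by apply/is_L2P => i j; split; have := square_integrable0 mu; congr sqint;
  apply/funext => x; rewrite mxE.
Qed.

Lemma re_hip_linear (a : R) f g h : L2 f -> L2 g -> L2 h ->
  re_hip (a%:C%C *: f + g) h = a * re_hip f h + re_hip g h.
Proof.
move=> /is_L2P Lf /is_L2P Lg /is_L2P Lh.
rewrite !re_hipE mulr_sumr -big_split; apply: eq_bigr => i _ /=.
rewrite mulr_sumr -big_split; apply: eq_bigr => j _ /=.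
have [fR fI] := Lf i j; have [gR gI] := Lg i j; have [hR hI] := Lh i j.
have ifh : mu.-integrable setT (EFin \o (fun x : borel G =>
    complex.Re (f x i j) * complex.Re (h x i j) +
    complex.Im (f x i j) * complex.Im (h x i j))).
  exact: integrable_mulD.
have igh : mu.-integrable setT (EFin \o (fun x : borel G =>
    complex.Re (g x i j) * complex.Re (h x i j) +
    complex.Im (g x i j) * complex.Im (h x i j))).
  exact: integrable_mulD.
rewrite -RintegralZl// -RintegralD//; last exact: (integrableZl measurableT a ifh).
by apply: eq_Rintegral => x _; rewrite !mxE ReD ImD ReM ImM /=; ring.
Qed.

(** Each real or imaginary part of each entry is summed by [riesz_fischer_geometric]; the squared
    norm is the finite sum over these components, so the constants add up. *)
Lemma re_hip_complete (u : nat -> Fn) (K w : R) : (forall n, L2 (u n)) ->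
  0 < w < 1 -> (forall n, re_hip (u n) (u n) <= K * (w ^+ n) ^+ 2) ->
  exists2 f, L2 f & exists L, forall n,
    re_hip (f - \sum_(k < n) u k) (f - \sum_(k < n) u k) <= L * w ^+ n.
Proof.
move=> Lu w01 uK.
pose part (b : bool) (z : R[i]) := if b then complex.Re z else complex.Im z.
have su b i j n : sqint (fun x => part b (u n x i j)).
  by have /is_L2P/(_ i j)[] := Lu n; case: b.
have isq b i j n : mu.-integrable setT
    (EFin \o (fun x : borel G => part b (u n x i j) ^+ 2)).
  exact: square_integrable_mul (su b i j n) (su b i j n).
have entry_le b i j n : \int[mu]_x (part b (u n x i j) ^+ 2) <= K * (w ^+ n) ^+ 2.
  apply: le_trans (uK n); rewrite re_hip_sqr.
  have c0 i' j' : 0 <= \int[mu]_x csq (u n x i' j').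
    by apply: Rintegral_ge0 => x _; rewrite addr_ge0// sqr_ge0.
  rewrite (bigD1 i)//= (bigD1 j)//= -addrA.
  apply: (@le_trans _ _ (\int[mu]_x csq (u n x i j))).
    apply: le_Rintegral => //.
      have sR := su true i j n; have sI := su false i j n.
      exact: (integrable_mulD sR sR sI sI).
    move=> x _; rewrite /csq; case: b => /=.
      by rewrite lerDl sqr_ge0.
    by rewrite lerDr sqr_ge0.
  by rewrite lerDl addr_ge0// ?sumr_ge0// => i' _; rewrite sumr_ge0.
have /choice[v vP] (c : bool * 'I_s * 'I_r) : exists v : borel G -> R,
    sqint v /\ exists L, forall n, \int[mu]_x
      ((v x - \sum_(k < n) part c.1.1 (u k x c.1.2 c.2)) ^+ 2) <= L * w ^+ n.
  have [v sv vL] := riesz_fischer_geometric w01 (su c.1.1 c.1.2 c.2)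
    (entry_le c.1.1 c.1.2 c.2).
  by exists v.
have /choice[L LP] (c : bool * 'I_s * 'I_r) : exists L, forall n, \int[mu]_x
    ((v c x - \sum_(k < n) part c.1.1 (u k x c.1.2 c.2)) ^+ 2) <= L * w ^+ n.
  by have [] := vP c.
pose f : Fn := fun x => \matrix_(i, j) Complex (v (true, i, j) x) (v (false, i, j) x).
exists f.
  apply/is_L2P => i j; split.
    by have [+ _] := vP (true, i, j); congr sqint; apply/funext => x; rewrite mxE.
  by have [+ _] := vP (false, i, j); congr sqint; apply/funext => x; rewrite mxE.
exists (\sum_(i < s) \sum_(j < r) (L (true, i, j) + L (false, i, j))) => n.
rewrite re_hip_sqr mulr_suml; apply: ler_sum => i _.
rewrite mulr_suml; apply: ler_sum => j _; rewrite mulrDl.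
apply: le_trans (lerD (LP (true, i, j) n) (LP (false, i, j) n)).
have isd b : mu.-integrable setT (EFin \o (fun x : borel G =>
    (v (b, i, j) x - \sum_(k < n) part b (u k x i j)) ^+ 2)).
  have [sv _] := vP (b, i, j).
  have sd := square_integrable_linear (-1) (square_integrable_sum n (su b i j)) sv.
  have := square_integrable_mul sd sd.
  by congr (_.-integrable _ _); apply/funext => x; rewrite /=; congr EFin; ring.
rewrite -RintegralD//.
rewrite le_eqVlt; apply/orP; left; apply/eqP; apply: eq_Rintegral => x _.
rewrite /csq.
have -> : (f - \sum_(k < n) u k) x i j = f x i j - \sum_(k < n) u k x i j.
  by rewrite !fctE !mxE fct_sumE summxE.
by rewrite ReB ImB Re_sum Im_sum mxE.
Qed.

Lemma re_hip_hilbert : hilbert_form L2 re_hip.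
Proof.
split.
- exact: is_L2_0.
- exact: is_L2_linear.
- move=> f g; rewrite !re_hipE; do 2 (apply: eq_bigr => ? _).
  by apply: eq_Rintegral => x _; rewrite !(mulrC (_ (g _ _ _))).
- exact: re_hip_linear.
- by move=> f _; exact: re_hip_ge0.
- exact: re_hip_complete.
Qed.

End MatrixL2.

(** * Bounded operators, matrix adjoints and perturbations of the identity *)

Section MatrixOperators.
Variables (R : realType) (G : topologicalZmodType).
Variables (mu : {measure set (borel G) -> \bar R}) (s r : nat).
Local Notation Fn := (G -> 'M[R[i]]_(s, r)).
Local Notation L2 := (@is_L2 R G mu s r).
Local Notation B := (@re_hip R G mu s r).
Implicit Types (f g h : Fn) (T S U V : Fn -> Fn).

Let HF : hilbert_form L2 B := re_hip_hilbert mu s r.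

Lemma is_L2D f g : L2 f -> L2 g -> L2 (f + g).
Proof. by move=> Lf Lg; rewrite -(scale1r f); exact: is_L2_linear. Qed.

Lemma is_L2B f g : L2 f -> L2 g -> L2 (f - g).
Proof. by move=> Lf Lg; rewrite -scaleN1r addrC; exact: is_L2_linear. Qed.

(** The parallelogram law without its difference term; it serves as a triangle inequality for
    squared norms. *)
Lemma re_hipD_le f g : L2 f -> L2 g ->
  B (f + g) (f + g) <= 2 * B f f + 2 * B g g.
Proof.
move=> Lf Lg; have Ld := is_L2B Lf Lg; have Ls := is_L2D Lf Lg.
have := re_hip_ge0 mu (f - g).
rewrite (formBl HF)// !(formBr HF)// (formDl HF)// !(formDr HF)//.
by rewrite (hilbert_formC HF g f); lra.
Qed.

Lemma l2eqD f g f' g' : L2 f -> L2 g -> L2 f' -> L2 g' ->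
  l2eq mu f f' -> l2eq mu g g' -> l2eq mu (f + g) (f' + g').
Proof.
move=> Lf Lg Lf' Lg' /l2eqE ef /l2eqE eg; apply/l2eqE/eqP.
rewrite eq_le re_hip_ge0 andbT opprD addrACA.
apply: le_trans (re_hipD_le (is_L2B Lf Lf') (is_L2B Lg Lg')) _.
by rewrite ef eg; lra.
Qed.

Lemma l2eq_trans f g h : L2 f -> L2 g -> L2 h ->
  l2eq mu f g -> l2eq mu g h -> l2eq mu f h.
Proof.
move=> Lf Lg Lh /l2eqE ef /l2eqE eg; apply/l2eqE/eqP.
rewrite eq_le re_hip_ge0 andbT -(subrKA g).
apply: le_trans (re_hipD_le (is_L2B Lf Lg) (is_L2B Lg Lh)) _.
by rewrite ef eg; lra.
Qed.

Lemma l2eq_refl f : l2eq mu f f.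
Proof. by apply/l2eqE; rewrite subrr (form0l HF)//; exact: is_L2_0. Qed.

Lemma fnorm_boundP U : (forall f, L2 f -> L2 (U f)) ->
  (exists K : R, forall f, L2 f -> fnorm mu (U f) <= K * fnorm mu f) <->
  (exists K : R, forall f, L2 f -> B (U f) (U f) <= K * B f f).
Proof.
move=> LU; split=> -[K UK].
  exists (K ^+ 2) => f Lf; have := UK f Lf; rewrite !fnormE => h.
  rewrite -(sqr_sqrtr (re_hip_ge0 mu (U f))) -[X in _ * X](sqr_sqrtr (re_hip_ge0 mu f)).
  rewrite -exprMn ler_sqr ?nnegrE ?sqrtr_ge0//.
  exact: le_trans h.
(* The absolute value is taken because [K] may be negative. *)
exists (Num.sqrt `|K|) => f Lf; rewrite !fnormE -sqrtrM ?normr_ge0//.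
rewrite ler_sqrt ?mulr_ge0 ?re_hip_ge0//.
apply: le_trans (UK f Lf) _.
by rewrite ler_wpM2r ?re_hip_ge0 ?ler_norm.
Qed.

Lemma bounded_linear_op_id : bounded_linear_op mu (id : Fn -> Fn).
Proof.
split => //; first by move=> a f g _ _; exact: l2eq_refl.
by exists 1 => f _; rewrite mul1r.
Qed.

Lemma bounded_linear_opD U V : bounded_linear_op mu U -> bounded_linear_op mu V ->
  bounded_linear_op mu (fun f x => U f x + V f x).
Proof.
move=> [LU eU lU bU] [LV eV lV bV]; split.
- by move=> f Lf; apply: is_L2D; [exact: LU|exact: LV].
- move=> f g Lf Lg fg.
  by apply: l2eqD; [exact: LU|exact: LV|exact: LU|exact: LV|exact: eU|exact: eV].
- move=> a f g Lf Lg.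
  have Lfg : L2 (a *: f + g) by exact: is_L2_linear.
  have -> : (fun x => a *: (U f x + V f x) + (U g x + V g x)) =
     (a *: U f + U g) + (a *: V f + V g).
    by apply/funext => x /=; rewrite scalerDr addrACA.
  apply: l2eqD; [exact: LU|exact: LV| | |exact: lU|exact: lV].
    by apply: is_L2_linear; exact: LU.
  by apply: is_L2_linear; exact: LV.
- move/fnorm_boundP : bU => /(_ LU)[K UK]; move/fnorm_boundP : bV => /(_ LV)[K' VK].
  apply/fnorm_boundP; first by move=> f Lf; apply: is_L2D; [exact: LU|exact: LV].
  exists (2 * K + 2 * K') => f Lf.
  apply: le_trans (re_hipD_le (LU _ Lf) (LV _ Lf)) _.
  by have := UK f Lf; have := VK f Lf; lra.
Qed.

Lemma bounded_linear_op_comp U V : bounded_linear_op mu U ->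
  bounded_linear_op mu V -> bounded_linear_op mu (U \o V).
Proof.
move=> [LU eU lU bU] [LV eV lV bV]; split => /=.
- by move=> f Lf; apply/LU/LV.
- move=> f g Lf Lg fg; apply: eU; [exact: LV|exact: LV|exact: eV].
- move=> a f g Lf Lg.
  have LVf := LV _ Lf; have LVg := LV _ Lg.
  have LVc : L2 (a *: V f + V g) by exact: is_L2_linear.
  have Lc : L2 (a *: f + g) by exact: is_L2_linear.
  apply: (@l2eq_trans _ (U (a *: V f + V g))).
  + by apply/LU/LV.
  + exact: LU.
  + by apply: is_L2_linear; exact: LU.
  + by apply: eU => //; [exact: LV|exact: lV].
  + exact: lU.
- move/fnorm_boundP : bU => /(_ LU)[K UK]; move/fnorm_boundP : bV => /(_ LV)[K' VK].
  apply/fnorm_boundP; first by move=> f Lf; apply/LU/LV.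
  exists (`|K| * K') => f Lf; apply: le_trans (UK _ (LV _ Lf)) _.
  apply: (@le_trans _ _ (`|K| * B (V f) (V f))).
    by rewrite ler_wpM2r ?re_hip_ge0 ?ler_norm.
  by rewrite -mulrA ler_wpM2l ?normr_ge0 ?VK.
Qed.

Lemma cintD (h1 h2 : G -> R[i]) :
  mu.-integrable setT (EFin \o (fun x : borel G => complex.Re (h1 x))) ->
  mu.-integrable setT (EFin \o (fun x : borel G => complex.Im (h1 x))) ->
  mu.-integrable setT (EFin \o (fun x : borel G => complex.Re (h2 x))) ->
  mu.-integrable setT (EFin \o (fun x : borel G => complex.Im (h2 x))) ->
  cint mu (fun x => h1 x + h2 x) = cint mu h1 + cint mu h2.
Proof.
move=> r1 i1 r2 i2; apply: complex_eq.
  by rewrite ReD /= -RintegralD//; apply: eq_Rintegral => x _; rewrite ReD.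
by rewrite ImD /= -RintegralD//; apply: eq_Rintegral => x _; rewrite ImD.
Qed.

Lemma integrable_Re_mul_conj f g i j k : L2 f -> L2 g ->
  mu.-integrable setT
    (EFin \o (fun x : borel G => complex.Re (f x i j * (g x k j)^*))).
Proof.
move=> /is_L2P/(_ i j)[fR fI] /is_L2P/(_ k j)[gR gI].
have := integrable_mulD fR gR fI gI.
by congr (_.-integrable _ _); apply/funext => x /=; rewrite -Re_mul_conj.
Qed.

Lemma integrable_Im_mul_conj f g i j k : L2 f -> L2 g ->
  mu.-integrable setT
    (EFin \o (fun x : borel G => complex.Im (f x i j * (g x k j)^*))).
Proof.
move=> /is_L2P/(_ i j)[fR fI] /is_L2P/(_ k j)[gR gI].
(* Negating the real part turns the difference in [Im_mul_conj] into a sum of products, as in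
   [integrable_mulD]. *)
have fR' := square_integrable_linear (-1) fR (square_integrable0 mu).
have := integrable_mulD fI gR fR' gI.
congr (_.-integrable _ _); apply/funext => x /=.
by rewrite Im_mul_conj; congr EFin; ring.
Qed.

Lemma mxipDl f g h : L2 f -> L2 g -> L2 h ->
  mxip mu (f + g) h = mxip mu f h + mxip mu g h.
Proof.
move=> Lf Lg Lh; apply/matrixP => i k; rewrite !mxE -big_split.
apply: eq_bigr => j _ /=.
rewrite -cintD; try exact: integrable_Re_mul_conj; try exact: integrable_Im_mul_conj.
by congr cint; apply/funext => x; rewrite mxE mulrDl.
Qed.

Lemma mxipDr f g h : L2 f -> L2 g -> L2 h ->
  mxip mu h (f + g) = mxip mu h f + mxip mu h g.
Proof.
move=> Lf Lg Lh; apply/matrixP => i k; rewrite !mxE -big_split.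
apply: eq_bigr => j _ /=.
rewrite -cintD; try exact: integrable_Re_mul_conj; try exact: integrable_Im_mul_conj.
by congr cint; apply/funext => x; rewrite mxE rmorphD mulrDr.
Qed.

(** The trace of the matrix identity is the Hilbert adjoint identity. *)
Lemma mx_adjointableP U : mx_adjointable mu U <-> exists V,
  bounded_linear_op mu V /\
  forall f g, L2 f -> L2 g -> mxip mu (U f) g = mxip mu f (V g).
Proof.
split=> [[V [[bV _] UV]]|[V [bV UV]]]; exists V => //.
by split=> //; split=> // f g Lf Lg; rewrite /hip UV.
Qed.

Lemma mx_adjointable_id : mx_adjointable mu (id : Fn -> Fn).
Proof.
by apply/mx_adjointableP; exists id; split => //; exact: bounded_linear_op_id.
Qed.

Lemma mx_adjointableD U V : bounded_linear_op mu U -> bounded_linear_op mu V ->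
  mx_adjointable mu U -> mx_adjointable mu V ->
  mx_adjointable mu (fun f x => U f x + V f x).
Proof.
move=> [LU _ _ _] [LV _ _ _].
move=> /mx_adjointableP[U' [bU' UU']] /mx_adjointableP[V' [bV' VV']].
have [LU' _ _ _] := bU'; have [LV' _ _ _] := bV'.
apply/mx_adjointableP; exists (fun f x => U' f x + V' f x); split.
  exact: bounded_linear_opD.
move=> f g Lf Lg.
rewrite (mxipDl (LU _ Lf) (LV _ Lf) Lg) UU'// VV'//.
by rewrite (mxipDr (LU' _ Lg) (LV' _ Lg) Lf).
Qed.

Lemma mx_adjointable_comp U V : bounded_linear_op mu U -> bounded_linear_op mu V ->
  mx_adjointable mu U -> mx_adjointable mu V -> mx_adjointable mu (U \o V).
Proof.
move=> [LU _ _ _] [LV _ _ _].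
move=> /mx_adjointableP[U' [bU' UU']] /mx_adjointableP[V' [bV' VV']].
have [LU' _ _ _] := bU'.
apply/mx_adjointableP; exists (V' \o U'); split.
  exact: bounded_linear_op_comp.
by move=> f g Lf Lg /=; rewrite UU' ?VV'//; [exact: LU'|exact: LV].
Qed.

Lemma positive_op_selfadjoint T : positive_op mu T -> form_selfadjoint L2 B T.
Proof.
move=> [[[LT _ _ _] adjT] _]; split => // f g Lf Lg.
by rewrite /re_hip adjT.
Qed.

Lemma positive_op_ge0 T : positive_op mu T -> form_ge0 L2 B T.
Proof. by move=> [_ T0] f Lf; have := T0 f Lf; rewrite lecE => /andP[]. Qed.

Lemma bounded_linear_op_bound T : bounded_linear_op mu T ->
  exists K : R, forall f, L2 f -> B (T f) (T f) <= K * B f f.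
Proof. by move=> [LT _ _ bT]; exact/fnorm_boundP. Qed.

(** Positivity of [T] makes [I + T] coercive with constant 1, so [coercive_inj] and [coercive_surj]
    apply. *)
Lemma op_bijective_id_add T : bounded_linear_op mu T ->
  form_selfadjoint L2 B T -> form_ge0 L2 B T ->
  op_bijective mu (fun f x => f x + T f x).
Proof.
move=> bT [LT adjT] T0.
pose P (f : Fn) : Fn := f + T f.
have LP f : L2 f -> L2 (P f) by move=> Lf; apply: is_L2D => //; exact: LT.
have adjP : form_selfadjoint L2 B P.
  split => // f g Lf Lg; have LTf := LT _ Lf; have LTg := LT _ Lg.
  by rewrite (formDl HF)// (formDr HF)// adjT.
have coerc f : L2 f -> B f f <= B (P f) f.
  by move=> Lf; rewrite (formDl HF) ?lerDl ?T0//; exact: LT.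
have [K PK] := bounded_linear_op_bound (bounded_linear_opD bounded_linear_op_id bT).
split => [f g Lf Lg /l2eqE e|g Lg].
  by apply/l2eqE; exact: (coercive_inj HF adjP).
have [f Lf e] := coercive_surj HF adjP coerc PK Lg.
by exists f => //; exact/l2eqE.
Qed.

(** The given basis [E] and the operator [I + T] are the witnesses. Every claim of the theorem is an
    instance, with [T], [S], their sum or their product as the perturbation. *)
Lemma mx_riesz_basis_id_add T (E : nat -> Fn) : bounded_linear_op mu T ->
  form_selfadjoint L2 B T -> form_ge0 L2 B T -> mx_adjointable mu T ->
  mx_onb mu E -> mx_riesz_basis mu (fun k x => E k x + T (E k) x).
Proof.
move=> bT adjT T0 aT onbE; exists E, (fun f x => f x + T f x); split => //.
- exact: bounded_linear_opD bounded_linear_op_id bT.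
- exact: op_bijective_id_add.
- exact: mx_adjointableD bounded_linear_op_id bT mx_adjointable_id aT.
- by move=> k; exact: l2eq_refl.
Qed.

End MatrixOperators.

Theorem theorem3p1 (R : realType) (G : topologicalZmodType)
  (mu : {measure set (borel G) -> \bar R}) (s r : nat)
  (HlcG : locally_compact_space G) (HmetG : metrizable_space R G)
  (HscG : sigma_compact_space G) (Hhaar : haar_measure mu)
  (T S : (G -> 'M[R[i]]_(s, r)) -> (G -> 'M[R[i]]_(s, r)))
  (E : nat -> (G -> 'M[R[i]]_(s, r)))
  (HTb : bounded_linear_op mu T) (HTp : positive_op mu T)
  (HTa : mx_adjointable mu T)
  (HSb : bounded_linear_op mu S) (HSp : positive_op mu S)
  (HSa : mx_adjointable mu S)
  (HE : mx_onb mu E) :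
  [/\ mx_riesz_basis mu (fun k x => E k x + T (E k) x)
      /\ mx_riesz_basis mu (fun k x => E k x + S (E k) x),
      mx_riesz_basis mu (fun k x => E k x + T (E k) x + S (E k) x) &
      ((forall f, is_L2 mu f -> l2eq mu (T (S f)) (S (T f))) ->
        mx_riesz_basis mu (fun k x => E k x + T (S (E k)) x))].
Proof.
have HF := re_hip_hilbert mu s r.
have adjT := positive_op_selfadjoint HTp; have adjS := positive_op_selfadjoint HSp.
have T0 := positive_op_ge0 HTp; have S0 := positive_op_ge0 HSp.
have [LT aT] := adjT; have [LS aS] := adjS.
split; first by split; exact: mx_riesz_basis_id_add.
  have -> : (fun k x => E k x + T (E k) x + S (E k) x) =
            (fun k x => E k x + (T (E k) x + S (E k) x)).
    by apply/funext => k; apply/funext => x; rewrite addrA.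
  apply: (@mx_riesz_basis_id_add _ _ _ _ _ (fun f x => T f x + S f x)) => //.
  - exact: bounded_linear_opD.
  - split=> [f Lf|f g Lf Lg]; first by apply: is_L2D; [exact: LT|exact: LS].
    rewrite (formDl HF (LT _ Lf) (LS _ Lf) Lg) aT// aS//.
    by rewrite (formDr HF (LT _ Lg) (LS _ Lg) Lf).
  - move=> f Lf; rewrite (formDl HF (LT _ Lf) (LS _ Lf) Lf).
    by rewrite addr_ge0 ?T0 ?S0.
  - exact: mx_adjointableD.
move=> TS.
(* Almost everywhere equality becomes equality under the form, since null vectors pair to zero. *)
have comm f g : is_L2 mu f -> is_L2 mu g ->
    re_hip mu (T (S f)) g = re_hip mu (S (T f)) g.
  move=> Lf Lg; have LTSf := LT _ (LS _ Lf); have LSTf := LS _ (LT _ Lf).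
  apply/eqP; rewrite -subr_eq0 -(formBl HF)//; apply/eqP.
  by apply: (form_eq0l HF) => //; [exact: is_L2B|exact/l2eqE/TS].
apply: (@mx_riesz_basis_id_add _ _ _ _ _ (T \o S)) => //.
- exact: bounded_linear_op_comp.
- split=> [f Lf|f g Lf Lg] /=; first exact/LT/LS.
  (* The adjoint of [T S] is [S T], which [comm] and symmetry of the form turn back into [T S]. *)
  rewrite aT ?aS//; [|exact: LT|exact: LS].
  by rewrite (hilbert_formC HF) -comm// (hilbert_formC HF).
- have [K SK] := bounded_linear_op_bound HSb.
  exact: (commuting_product_ge0 HF adjT T0 adjS S0 SK comm).
- exact: mx_adjointable_comp.
Qed.
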